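(* Let $X$ be a real Hilbert space and let $A:X\rightrightarrows X$ and $B:X\rightrightarrows X$ be maximally monotone operators. Suppose that $A$ is an affine relation. Then the following hold: \begin{enumerate} \item[(i)] For every $n\in\mathbb{N}$, $R_AT_{A,B}^n=T_{B,A}^nR_A$. \item[(ii)] $R_A(Z)=J_A(\operatorname{Fix} T_{B,A})$ and $R_A(K)=(J_A-\operatorname{Id})(-\operatorname{Fix} T_{B,A})$. \end{enumerate} If, in addition, $B$ is an affine relation, then moreover: \begin{enumerate} \item[(iii)] $T_{A,B}R_BR_A=R_BR_AT_{A,B}$. \item[(iv)] $4(T_{A,B}T_{B,A}-T_{B,A}T_{A,B})=R_BR_A^2R_B-R_AR_B^2R_A$. Consequently, $T_{A,B}T_{B,A}=T_{B,A}T_{A,B}$ if and only if $R_BR_A^2R_B=R_AR_B^2R_A$. \item[(v)] If $R_A^2=R_B^2=\operatorname{Id}$, then $T_{A,B}T_{B,A}=T_{B,A}T_{A,B}$. \end{enumerate}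
   Context: $\operatorname{Id}$ is the identity on $X$. An operator $A:X\rightrightarrows X$ is an affine relation if its graph is an affine subspace of $X\times X$. For a maximally monotone operator $A$, $J_A=(\operatorname{Id}+A)^{-1}$ is the resolvent (single-valued, defined on all of $X$) and $R_A=2J_A-\operatorname{Id}$ is the reflected resolvent. The Douglas--Rachford operator of the ordered pair $(A,B)$ is $T_{A,B}=\tfrac12(\operatorname{Id}+R_BR_A)=\operatorname{Id}-J_A+J_BR_A$; correspondingly $T_{B,A}=\tfrac12(\operatorname{Id}+R_AR_B)$. Products and powers of operators denote composition. $\operatorname{Fix} T=\{x\in X: x=Tx\}$. The sets of primal and dual solutions are $Z=(A+B)^{-1}(0)$ and $K=(A^{-1}+(-\operatorname{Id})\circ B^{-1}\circ(-\operatorname{Id}))^{-1}(0)$. For $C\subseteq X$, $-C=\{-c : c\in C\}$. *)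

(* Defs.v *)
From HB Require Import structures.
From mathcomp Require Import all_boot all_order all_algebra.
From mathcomp Require Import sesquilinear.
From mathcomp Require Import all_classical all_reals all_analysis.
Import Order.TTheory GRing.Theory Num.Theory.
Import numFieldNormedType.Exports.
Set Implicit Arguments.
Unset Strict Implicit.
Unset Printing Implicit Defensive.
Local Open Scope classical_set_scope.
Local Open Scope ring_scope.

(* A real Hilbert space is a complete normed module [X] over a [realType],
   together with a positive definite symmetric bilinear form that induces
   the norm. *)
Definition induces_norm (R : realType) (X : completeNormedModType R)
    (ip : {dot X for (@idfun R)}) : Prop :=
  forall x : X, `|x| = Num.sqrt (ip x x).

Section SetValuedOperators.
Context {R : realType} {X : lmodType R}.

Definition operator := X -> set X.

Implicit Types A B : operator.

Definition graph A : set (X * X) := [set p | A p.1 p.2].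

Definition op_fun (f : X -> X) : operator := fun x => [set f x].

Definition op_inv A : operator := fun u => [set x | A x u].

Definition op_add A B : operator :=
  fun x => [set u + v | u in A x & v in B x].

(* [op_comp A B] applies [B] first. *)
Definition op_comp A B : operator := fun x => \bigcup_(y in B x) A y.

Definition affine_subspace (E : lmodType R) (C : set E) : Prop :=
  C !=set0 /\
  forall (l : R) (x y : E), C x -> C y -> C ((1 - l) *: x + l *: y).

Definition affine_relation A : Prop := affine_subspace (graph A).

(* The value of [(Id + A)^-1] at [x], chosen arbitrarily if there are several
   and defaulting to [0] if there is none; for a maximally monotone [A] on a
   Hilbert space, there is exactly one. *)
Definition resolvent A : X -> X :=
  fun x => xget 0 (op_inv (op_add (op_fun idfun) A) x).

Definition reflected_resolvent A : X -> X :=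
  fun x => 2 *: resolvent A x - x.

Definition douglas_rachford A B : X -> X :=
  fun x => 2^-1 *: (x + reflected_resolvent B (reflected_resolvent A x)).

Definition fixed_points (T : X -> X) : set X := [set x | x = T x].

Definition primal_solutions A B : set X := op_inv (op_add A B) 0.

Definition dual_solutions A B : set X :=
  op_inv
    (op_add (op_inv A)
            (op_comp (op_fun -%R) (op_comp (op_inv B) (op_fun -%R)))) 0.

End SetValuedOperators.

Arguments operator {R} X.

Section Monotonicity.
Context {R : realType} {X : completeNormedModType R}.
Variable ip : {dot X for (@idfun R)}.

Definition monotone_operator (A : operator X) : Prop :=
  forall x u y v : X, A x u -> A y v -> 0 <= ip (x - y) (u - v).

Definition maximally_monotone (A : operator X) : Prop :=
  monotone_operator A /\
  forall B : operator X,
    monotone_operator B -> graph A `<=` graph B -> graph B = graph A.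

End Monotonicity.

(* Main.v *)
Require Import Defs.
From mathcomp Require Import all_boot all_order all_algebra.
From mathcomp Require Import sesquilinear.
From mathcomp Require Import all_classical all_reals all_analysis.
From mathcomp Require Import ring lra.
Import Order.TTheory GRing.Theory Num.Theory.
Import numFieldNormedType.Exports.
Local Open Scope classical_set_scope.
Local Open Scope ring_scope.

(** The Douglas-Rachford operator is the midpoint of the identity and of
    [R_B R_A]. An affine map preserves midpoints, so as soon as [R_A] is affine
    it intertwines [T_AB] with [T_BA], hence also their powers. When [R_B] is
    affine too, [R_B R_A] commutes with its midpoint with the identity, and
      [4 T_AB T_BA = Id + R_A R_B + R_B R_A + R_B R_A^2 R_B]
    ([douglas_rachford_comp]); exchanging [A] and [B] changes only the last
    term, which gives the formula for the commutator and its consequences.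

    For the images of [Z] and [K], [T_AB] has the same fixed points as
    [R_B R_A], and [R_A] maps the fixed points of [R_B R_A] onto those of
    [R_A R_B]. Moreover [J_A] maps
    [Fix T_AB] onto [Z] and [Id - J_A] maps it onto [K]
    ([primal_solutionsE], [dual_solutionsE]). What remains is to move [R_A] past
    [J_A] and past [Id - J_A], which again only uses that [J_A] is affine.

    All of this requires that resolvents be defined everywhere, which is
    Minty's theorem ([minty]): if [A] is maximally monotone, every [z] is in the
    range of [Id + A]. The proof given here minimises, over pairs [(x, u)],
      [sup (|x + v|^2 + |u + y|^2 - |y + v|^2)]
    with [(y, v)] ranging over the graph. This is twice the Fitzpatrick function
    of [A] plus [|x|^2 + |u|^2]. It is uniformly convex, so that a minimising
    sequence is Cauchy and a minimiser [(x, u)] exists by completeness.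
    Maximality makes the minimum at least [|x + u|^2], and the variational
    inequality at the minimiser then forces [u = - x] and [(x, - x)] to lie in
    the graph. *)

Set Implicit Arguments.
Unset Strict Implicit.
Unset Printing Implicit Defensive.

(** * Convergence of sequences *)

Section Sequences.
Context {R : realType} {X : completeNormedModType R}.

Lemma cvg_of_sqr_dist_le (u : nat -> X) (c : R) :
  (forall n k, (n <= k)%N -> `|u n - u k| ^+ 2 <= c * harmonic n) ->
  cvgn u.
Proof.
move=> u_close; apply/cauchy_cvgP/cauchyP => e e_gt0 /=.
have : (fun n => c * harmonic n : R) @ \oo --> c * 0.
  by apply: cvgM; [exact: cvg_cst | exact: cvg_harmonic].
rewrite mulr0 => /cvgr_lt/(_ (e ^+ 2)); rewrite exprn_gt0//.
move=> /(_ isT)[N _ N_e].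
exists (u N); exists N => // k Nk /=.
rewrite -ball_normE /ball_ /=.
move: (le_lt_trans (u_close N k Nk) (N_e N (leqnn N))).
by rewrite ltr_pXn2r ?nnegrE ?(ltW e_gt0) ?normr_ge0.
Qed.

Lemma norm2_cvg (u : nat -> X) (x y : X) :
  u @ \oo --> x -> (fun n => `|u n + y| ^+ 2) @ \oo --> `|x + y| ^+ 2.
Proof.
move=> u_x; rewrite expr2; under eq_fun do rewrite expr2.
have : (fun n => `|u n + y|) @ \oo --> `|x + y|.
  by apply: cvg_norm; apply: cvgD => //; exact: cvg_cst.
by move=> cv; apply: cvgM.
Qed.

End Sequences.

(** * Minimisation of the Fitzpatrick function *)

Section Minty.
Context {R : realType} {X : completeNormedModType R}.
Variable ip : {dot X for (@idfun R)}.

Lemma ip_sym x y : ip x y = ip y x.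
Proof. by rewrite (hermC ip) /= expr0 mul1r. Qed.

Lemma ipDl x y z : ip (x + y) z = ip x z + ip y z.
Proof. exact: linearDl. Qed.
Lemma ipDr x y z : ip z (x + y) = ip z x + ip z y.
Proof. exact: linearDr. Qed.
Lemma ipNl x z : ip (- x) z = - ip x z.
Proof. exact: linearNl. Qed.
Lemma ipNr x z : ip z (- x) = - ip z x.
Proof. exact: linearNr. Qed.
Lemma ipZl a x z : ip (a *: x) z = a * ip x z.
Proof. exact: linearZl_LR. Qed.
Lemma ipZr a x z : ip z (a *: x) = a * ip z x.
Proof. exact: linearZr_LR. Qed.
Definition ipE := (ipDl, ipDr, ipNl, ipNr, ipZl, ipZr).

Lemma ip_ge0 x : 0 <= ip x x.
Proof.
have [->|x_neq0] := eqVneq x 0; first by rewrite linear0r.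
exact/ltW/neq0_dnorm_gt0.
Qed.

Hypothesis ip_norm : induces_norm ip.

Lemma normr_sqr x : `|x| ^+ 2 = ip x x.
Proof. by rewrite ip_norm sqr_sqrtr// ip_ge0. Qed.

Lemma ip_eq0 x : ip x x <= 0 -> x = 0.
Proof.
move=> x_le0; apply: normr0_eq0; apply/eqP; rewrite -sqrf_eq0 normr_sqr.
by rewrite eq_le x_le0 ip_ge0.
Qed.

(** The defect of convexity of the squared norm does not depend on the
    translation [v]. This is why a supremum over [v] of such functions is still
    uniformly convex. *)
Lemma ip_convex s x y v :
  let z := (1 - s) *: x + s *: y + v in
  ip z z = (1 - s) * ip (x + v) (x + v) + s * ip (y + v) (y + v)
           - s * (1 - s) * ip (x - y) (x - y).
Proof.
rewrite /= !ipE (ip_sym y x) (ip_sym v x) (ip_sym v y); ring.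
Qed.

Implicit Types (G : set (X * X)) (p q : X * X).

(** The sublevel sets of twice the Fitzpatrick function of [G] plus the squared
    norm of [p]. Working with sublevel sets avoids the infinite values that the
    supremum may take; completing squares leaves only squared norms, so
    that closedness is continuity of the norm. *)
Definition fitzpatrick_level G (r : R) : set (X * X) :=
  [set p | forall q, G q ->
    ip (p.1 + q.2) (p.1 + q.2) + ip (p.2 + q.1) (p.2 + q.1)
    <= r + ip (q.1 + q.2) (q.1 + q.2)].

Definition sqdist p q : R :=
  ip (p.1 - q.1) (p.1 - q.1) + ip (p.2 - q.2) (p.2 - q.2).

Lemma fitzpatrick_level_le G r r' p :
  r <= r' -> fitzpatrick_level G r p -> fitzpatrick_level G r' p.
Proof. by move=> rr' Gp q /Gp /le_trans; apply; rewrite lerD2r. Qed.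

Lemma fitzpatrick_level_convex G a b p q s : 0 <= s <= 1 ->
  fitzpatrick_level G a p -> fitzpatrick_level G b q ->
  fitzpatrick_level G ((1 - s) * a + s * b - s * (1 - s) * sqdist p q)
    ((1 - s) *: p + s *: q).
Proof.
move=> /andP[s0 s1] Gp Gq w Gw; rewrite /= !ip_convex /sqdist.
have s1' : 0 <= 1 - s by rewrite subr_ge0.
have := lerD (ler_wpM2l s1' (Gp w Gw)) (ler_wpM2l s0 (Gq w Gw)).
nra.
Qed.

(** By [fitzpatrick_level_convex] with weight [1/2], two points of the levels
    [a] and [b] have a midpoint of level [(a + b) / 2 - sqdist / 4]. Since no
    level below the infimum is populated, points of nearly minimal level are
    close to each other. *)
Lemma fitzpatrick_min G :
  (exists r, fitzpatrick_level G r !=set0) ->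
  (forall r p, fitzpatrick_level G r p -> 0 <= r) ->
  exists m p, fitzpatrick_level G m p /\
    forall r q, fitzpatrick_level G r q -> m <= r.
Proof.
move=> [r0 [p0 Gp0]] G_ge0.
pose E := [set r | fitzpatrick_level G r !=set0].
have E_lb : lbound E 0 by move=> r [p /G_ge0].
have E_inf : has_inf E by split; [exists r0, p0 | exists 0].
have m_min r q : fitzpatrick_level G r q -> inf E <= r.
  by move=> Gq; apply: ge_inf; [exists 0 | exists q].
have /choice[p p_inf] n : exists p, fitzpatrick_level G (inf E + harmonic n) p.
  have [r [q Gq] r_lt] := inf_adherent (harmonic_gt0 n : 0 < _ :> R) E_inf.
  by exists q; exact: fitzpatrick_level_le (ltW r_lt) Gq.
have p_close n k : (n <= k)%N -> sqdist (p n) (p k) <= 4 * harmonic n.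
  move=> nk.
  have h01 : (0 : R) <= (2^-1 : R) <= (1 : R) by apply/andP; split; lra.
  have := m_min _ _ (fitzpatrick_level_convex h01 (p_inf n) (p_inf k)).
  have : harmonic k <= harmonic n :> R.
    by rewrite /harmonic /= lef_pV2 ?posrE// ler_nat.
  lra.
have cvg1 : cvgn (fun n => (p n).1).
  apply: (@cvg_of_sqr_dist_le _ _ _ 4) => n k nk; rewrite normr_sqr.
  have := ip_ge0 ((p n).2 - (p k).2).
  by have := p_close n k nk; rewrite /sqdist; lra.
have cvg2 : cvgn (fun n => (p n).2).
  apply: (@cvg_of_sqr_dist_le _ _ _ 4) => n k nk; rewrite normr_sqr.
  have := ip_ge0 ((p n).1 - (p k).1).
  by have := p_close n k nk; rewrite /sqdist; lra.
exists (inf E), (limn (fun n => (p n).1), limn (fun n => (p n).2)); split => //.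
move=> q Gq; rewrite -!normr_sqr /=.
have lhs_cvg := cvgD (norm2_cvg (y := q.2) cvg1) (norm2_cvg (y := q.1) cvg2).
have rhs_cvg : (fun n => inf E + harmonic n + `|q.1 + q.2| ^+ 2) @ \oo
    --> inf E + 0 + `|q.1 + q.2| ^+ 2.
  apply: cvgD; last exact: cvg_cst.
  by apply: cvgD; [exact: cvg_cst | exact: cvg_harmonic].
rewrite addr0 in rhs_cvg.
apply: (ler_cvg_to (lhs_cvg _) rhs_cvg); near=> n => /=.
by rewrite fctE /= !normr_sqr; exact: p_inf.
Unshelve. all: by end_near.
Qed.

(** Minty's theorem at the origin, for a maximally monotone graph [G]. *)
Lemma minty_origin G : G !=set0 ->
  (forall p q, G p -> G q -> 0 <= ip (p.1 - q.1) (p.2 - q.2)) ->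
  (forall p, (forall q, G q -> 0 <= ip (p.1 - q.1) (p.2 - q.2)) -> G p) ->
  exists x, G (x, - x).
Proof.
move=> G0 G_mono G_max.
(* The Fitzpatrick function dominates the inner product: otherwise [p] would
   be strictly related to the whole graph, hence to itself. *)
have level_ge r p : fitzpatrick_level G r p -> ip (p.1 + p.2) (p.1 + p.2) <= r.
  move=> Gp; rewrite leNgt; apply/negP => r_lt.
  have : G p.
    apply: G_max => q Gq; have := Gp q Gq; move: r_lt; rewrite !ipE.
    rewrite (ip_sym p.2 p.1) (ip_sym q.2 q.1) (ip_sym q.2 p.1) (ip_sym q.1 p.2).
    by lra.
  by move=> /Gp; move: r_lt; rewrite (addrC p.2); lra.
have level_ge0 r p : fitzpatrick_level G r p -> 0 <= r.
  by move=> /level_ge; apply: le_trans; exact: ip_ge0.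
(* On the graph, the Fitzpatrick function equals the inner product. *)
have graph_level q : G q -> fitzpatrick_level G (ip (q.1 + q.2) (q.1 + q.2)) q.
  move=> Gq w Gw; have := G_mono q w Gq Gw; rewrite !ipE.
  rewrite (ip_sym q.2 q.1) (ip_sym w.2 w.1) (ip_sym w.2 q.1) (ip_sym w.1 q.2).
  lra.
have [|m [p [Gp m_min]]] := fitzpatrick_min _ level_ge0.
  have [q Gq] := G0; exists (ip (q.1 + q.2) (q.1 + q.2)), q.
  exact: graph_level.
(* Variational inequality: moving from [p] towards [q] by a fraction [s] must
   not go below [m]. The inequality is the limit [s -> 0]; should it fail, the
   value [s] below, for which [(1 - s) * D] is halfway between [c] and [D],
   is already contradictory. *)
have var q : G q -> sqdist p q <= ip (q.1 + q.2) (q.1 + q.2) - m.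
  move=> Gq; set c := _ - m; set D := sqdist p q.
  rewrite leNgt; apply/negP => c_lt.
  have c_ge0 : 0 <= c by rewrite subr_ge0; exact: m_min (graph_level q Gq).
  have D_gt0 : 0 < D by exact: le_lt_trans c_lt.
  pose s := (D - c) / (2 * D).
  have sD : s * D = (D - c) / 2 by rewrite /s; field; rewrite gt_eqF.
  have s_gt0 : 0 < s by rewrite divr_gt0 ?subr_gt0 ?mulr_gt0.
  have s_le1 : s <= 1 by rewrite ler_pdivrMr ?mulr_gt0//; lra.
  have s01 : 0 <= s <= 1 by rewrite ltW.
  have := m_min _ _ (fitzpatrick_level_convex s01 Gp (graph_level q Gq)).
  rewrite -/D; have -> : ip (q.1 + q.2) (q.1 + q.2) = c + m by rewrite subrK.
  have -> : (1 - s) * m + s * (c + m) - s * (1 - s) * D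
      = m + s * (c - D + s * D) by ring.
  by rewrite sD lerDl pmulr_rge0//; lra.
(* Completing the squares in [var], with [m >= |p.1 + p.2|^2]. *)
have key q : G q ->
    ip (p.1 + p.2) (p.1 + p.2) <= ip (q.1 + p.2) (q.2 + p.1).
  move=> Gq; have := var q Gq; have := level_ge _ _ Gp; rewrite /sqdist !ipE.
  rewrite (ip_sym p.2 p.1) (ip_sym q.2 q.1) (ip_sym q.2 p.2) (ip_sym q.1 p.1).
  lra.
have Gnp : G (- p.2, - p.1).
  apply: G_max => q /key; rewrite /= -!opprD ipNl ipNr opprK.
  rewrite !(addrC q.1) !(addrC q.2).
  by rewrite (addrC p.1 q.2) (addrC _ q.1); apply: le_trans; exact: ip_ge0.
have /ip_eq0 p12 : ip (p.1 + p.2) (p.1 + p.2) <= 0.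
  by have := key _ Gnp; rewrite /= addNr linear0l.
have p2E : - p.2 = p.1 by apply/esym/eqP; rewrite -addr_eq0 p12.
by exists p.1; rewrite -{1}p2E.
Qed.

End Minty.

(** * Minty's theorem and resolvents *)

Section Resolvents.
Context {R : realType} {X : completeNormedModType R}.
Variable ip : {dot X for (@idfun R)}.
Hypothesis ip_norm : induces_norm ip.
Implicit Types A B : operator X.

(** A pair monotonically related to the graph can be adjoined to it, so
    maximality puts it there already. *)
Lemma maximally_monotoneP A x u : maximally_monotone ip A ->
  (forall y v, A y v -> 0 <= ip (x - y) (u - v)) -> A x u.
Proof.
move=> [A_mono A_max] xu_A.
pose A' : operator X := fun y => [set v | A y v \/ (y = x /\ v = u)].
suff A'_mono : monotone_operator ip A'.
  have A'A : graph A' = graph A by apply: A_max => // p; left.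
  by suff: graph A (x, u) by []; rewrite -A'A; right.
move=> y v z w /= [Ayv|[-> ->]] [Azw|[-> ->]].
- exact: A_mono.
- by rewrite -(opprB x) -(opprB u) ipNl ipNr opprK; exact: xu_A.
- exact: xu_A.
- by rewrite !subrr linear0l.
Qed.

Lemma graph_nonempty A : maximally_monotone ip A -> graph A !=set0.
Proof.
move=> A_max; apply: contrapT => A0; apply: (A0); exists (0, 0).
by apply: maximally_monotoneP => // y v Ayv; case: A0; exists (y, v).
Qed.

(** The translation [v |-> v - z] reduces this to [minty_origin]. *)
Lemma minty A z : maximally_monotone ip A -> exists x, A x (z - x).
Proof.
move=> A_max.
pose G : set (X * X) := [set p | A p.1 (p.2 + z)].
have shift (u v : X) : u - v = (u + z) - (v + z).
  by rewrite opprD addrACA subrr addr0.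
have [|||x] := minty_origin ip_norm (G := G).
- have [[y v] Ayv] := graph_nonempty A_max.
  by exists (y, v - z); rewrite /G /= subrK.
- by move=> p q Gp Gq; rewrite (shift p.2); exact: A_max.1.
- move=> p p_G; apply: maximally_monotoneP => // y v Ayv.
  have := p_G (y, v - z); rewrite /G /= subrK => /(_ Ayv).
  by rewrite (shift p.2) subrK.
- by rewrite /G /= addrC; exists x.
Qed.

(** Existence of a value of [(Id + A)^-1] is [minty]; uniqueness holds because
    two values [a], [b] satisfy [0 <= ip (a - b) (b - a)] by monotonicity. *)
Lemma resolventP A x a : maximally_monotone ip A ->
  resolvent A x = a <-> A a (x - a).
Proof.
move=> A_max.
have Jx : A (resolvent A x) (x - resolvent A x).
  have [b Ab] := minty x A_max.
  have : op_inv (op_add (op_fun idfun) A) x (resolvent A x).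
    apply: (@xgetPex _ 0); exists b; exists b => //; exists (x - b) => //.
    by rewrite addrC subrK.
  by move=> [_ -> [v Av xE]]; rewrite -{2}xE addrAC subrr add0r.
split=> [<- //|Aa]; apply/eqP; rewrite -subr_eq0; apply/eqP/(ip_eq0 ip_norm).
have := A_max.1 _ _ _ _ Jx Aa.
rewrite (_ : _ - (x - a) = - (resolvent A x - a)) ?ipNr ?oppr_ge0 //.
by rewrite !opprB addrC addrA subrK.
Qed.

End Resolvents.

(** * Affine maps *)

Section AffineMaps.
Context {R : realType} {X : lmodType R}.
Implicit Types f g : X -> X.

Definition affine_map f := forall (l : R) x y,
  f ((1 - l) *: x + l *: y) = (1 - l) *: f x + l *: f y.

Lemma affine_map_mid f x y : affine_map f ->
  f (2^-1 *: (x + y)) = 2^-1 *: (f x + f y).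
Proof.
have half : 1 - 2^-1 = 2^-1 :> R by field.
by move=> /(_ 2^-1 x y); rewrite half -!scalerDr.
Qed.

Lemma affine_map_reflect f x y : affine_map f ->
  f (2 *: x - y) = 2 *: f x - f y.
Proof.
have e : 1 - 2 = -1 :> R by ring.
by move=> /(_ 2 y x); rewrite e !scaleN1r ![- _ + _]addrC.
Qed.

Lemma affine_map_comp f g : affine_map f -> affine_map g -> affine_map (f \o g).
Proof. by move=> f_aff g_aff l x y; rewrite /= g_aff f_aff. Qed.

End AffineMaps.

(** * Algebra of Douglas-Rachford operators *)

Section DouglasRachford.
Context {R : realType} {X : lmodType R}.
Implicit Types A B : operator X.

Lemma scaler2 (x : X) : 2 *: x = x + x.
Proof. by rewrite scaler_nat mulr2n. Qed.

Lemma half_scale (x : X) : 2^-1 *: (x + x) = x.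
Proof. by rewrite -scaler2 scalerA mulVf ?scale1r ?pnatr_eq0. Qed.

Lemma affine_reflected_resolvent A :
  affine_map (resolvent A) -> affine_map (reflected_resolvent A).
Proof.
move=> J_aff l x y; rewrite /reflected_resolvent J_aff.
rewrite !scalerBr scalerDr opprD addrACA !scalerA.
by rewrite ![_ * 2]mulrC.
Qed.

Lemma fixed_points_douglas_rachford A B x :
  fixed_points (douglas_rachford A B) x <->
  reflected_resolvent B (reflected_resolvent A x) = x.
Proof.
rewrite /fixed_points /douglas_rachford /=; split=> [xE|->]; last first.
  by rewrite half_scale.
have : x + x = x + reflected_resolvent B (reflected_resolvent A x).
  rewrite -[LHS]scaler2 {1}xE scalerA mulfV ?scale1r ?pnatr_eq0 //.
by move=> /addrI.
Qed.

(** [x |-> R_A x] and [y |-> R_B y] are mutually inverse bijections between the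
    fixed points of [R_B R_A] and those of [R_A R_B]. *)
Lemma reflected_fixed_points A B :
  reflected_resolvent A @` fixed_points (douglas_rachford A B) =
  fixed_points (douglas_rachford B A).
Proof.
apply/seteqP; split=> [_ [x /fixed_points_douglas_rachford Fx <-]|y].
  by apply/fixed_points_douglas_rachford; rewrite Fx.
move=> /fixed_points_douglas_rachford Fy.
exists (reflected_resolvent B y) => //.
by apply/fixed_points_douglas_rachford; rewrite Fy.
Qed.

Lemma reflected_douglas_rachford A B :
  affine_map (reflected_resolvent A) ->
  reflected_resolvent A \o douglas_rachford A B =
  douglas_rachford B A \o reflected_resolvent A.
Proof. by move=> RA_aff; apply/funext => x; exact: affine_map_mid. Qed.

Lemma iter_intertwine (T : Type) (f g h : T -> T) n :
  f \o g = h \o f -> f \o iter n g = iter n h \o f.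
Proof.
move=> fg; apply/funext => x /=; elim: n => //= n <-.
exact: (congr1 (@^~ _) fg).
Qed.

(** The sum of the first three terms is symmetric in [A] and [B], so it cancels
    in the commutator of the two Douglas-Rachford operators. *)
Lemma douglas_rachford_comp A B x :
  affine_map (reflected_resolvent A) -> affine_map (reflected_resolvent B) ->
  let RA := reflected_resolvent A in let RB := reflected_resolvent B in
  4 *: douglas_rachford A B (douglas_rachford B A x) =
  x + RA (RB x) + RB (RA x) + RB (RA (RA (RB x))).
Proof.
move=> RA_aff RB_aff /=.
rewrite {1}/douglas_rachford.
rewrite (affine_map_mid _ _ RA_aff) (affine_map_mid _ _ RB_aff).
rewrite -scalerDr !scalerA (_ : 4 / 2 / 2 = 1) ?scale1r ?addrA //.
by field.
Qed.

End DouglasRachford.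

(** * Fixed points, primal and dual solutions *)

Section Solutions.
Context {R : realType} {X : completeNormedModType R}.
Variable ip : {dot X for (@idfun R)}.
Hypothesis ip_norm : induces_norm ip.
Variables A B : operator X.
Hypotheses (A_max : maximally_monotone ip A) (B_max : maximally_monotone ip B).

(** The graph of [J_A] is the image of the graph of [A] under the linear map
    [(a, u) |-> (a + u, a)]. *)
Lemma affine_resolvent : affine_relation A -> affine_map (resolvent A).
Proof.
move=> [_ A_aff] l x y; apply/(resolventP ip_norm _ _ A_max).
have Jx : graph A (resolvent A x, x - resolvent A x).
  exact/(resolventP ip_norm x _ A_max).
have Jy : graph A (resolvent A y, y - resolvent A y).
  exact/(resolventP ip_norm y _ A_max).
by have := A_aff l _ _ Jx Jy; rewrite /graph /= !scalerBr opprD addrACA.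
Qed.

(** [x] is fixed if and only if [J_B R_A x = J_A x]. The pair
    [(J_A x, x - J_A x)] is then in the graph of [A] and its opposite slope is
    in that of [B]: the two components are a primal and a dual solution. *)
Lemma fixed_pointsP x : fixed_points (douglas_rachford A B) x <->
  B (resolvent A x) (resolvent A x - x).
Proof.
have -> : resolvent A x - x = reflected_resolvent A x - resolvent A x.
  by rewrite /reflected_resolvent scaler2 addrAC addrK.
apply: iff_trans (fixed_points_douglas_rachford _ _ _) _.
apply: iff_trans (resolventP ip_norm _ _ B_max).
rewrite {1}/reflected_resolvent; set b := resolvent B _.
rewrite /reflected_resolvent opprB addrCA -scalerBr.
split=> [/eqP|->]; last by rewrite subrr scaler0 addr0.
rewrite -subr_eq0 addrAC subrr add0r scaler_eq0 pnatr_eq0 /= subr_eq0.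
by move=> /eqP.
Qed.

(** If [u] in [A z] and [- u] in [B z], the fixed point over [z] is [z + u]. *)
Lemma primal_solutionsE :
  primal_solutions A B = resolvent A @` fixed_points (douglas_rachford A B).
Proof.
apply/seteqP; split=> [z [u Au [v Bv uv0]]|_ [x /fixed_pointsP Bx <-]].
  have Jz : resolvent A (z + u) = z.
    by apply/(resolventP ip_norm _ _ A_max); rewrite addrAC subrr add0r.
  exists (z + u) => //; apply/fixed_pointsP; rewrite Jz opprD addNKr.
  by rewrite (_ : - u = v) //; apply/eqP; rewrite eq_sym -addr_eq0 addrC uv0.
exists (x - resolvent A x); first exact/(resolventP ip_norm _ _ A_max).
by exists (resolvent A x - x) => //; rewrite addrA subrK subrr.
Qed.

(** If [k] in [A a] and [- k] in [B a], the fixed point over [k] is [a + k]: the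
    correspondence is that of [primal_solutionsE], read on the other
    component. *)
Lemma dual_solutionsE :
  dual_solutions A B =
  (fun x => x - resolvent A x) @` fixed_points (douglas_rachford A B).
Proof.
apply/seteqP; split=> [k [a Aa [_ [y [w /= -> By] ->] ay]]|
                       _ [x /fixed_pointsP Bx <-]].
  have {}ay : a = y by apply/eqP; rewrite -subr_eq0 ay.
  rewrite -{}ay in By.
  have Ja : resolvent A (a + k) = a.
    by apply/(resolventP ip_norm _ _ A_max); rewrite addrAC subrr add0r.
  exists (a + k); last by rewrite Ja addrAC subrr add0r.
  by apply/fixed_pointsP; rewrite Ja opprD addNKr.
exists (resolvent A x); first exact/(resolventP ip_norm _ _ A_max).
exists (- resolvent A x); last by rewrite subrr.
exists (resolvent A x) => //; exists (- (x - resolvent A x)) => //.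
by rewrite opprB.
Qed.

End Solutions.

Unset Implicit Arguments.

Theorem proposition2p4 (R : realType) (X : completeNormedModType R)
    (ip : {dot X for (@idfun R)}) (ip_norm : induces_norm ip)
    (A B : operator X)
    (A_max : maximally_monotone ip A) (B_max : maximally_monotone ip B)
    (A_aff : affine_relation A) :
  let J_A := resolvent A in
  let R_A := reflected_resolvent A in
  let R_B := reflected_resolvent B in
  let T_AB := douglas_rachford A B in
  let T_BA := douglas_rachford B A in
  let Z := primal_solutions A B in
  let K := dual_solutions A B in
  [/\ forall n : nat, R_A \o iter n T_AB = iter n T_BA \o R_A,
      R_A @` Z = J_A @` fixed_points T_BA /\
      R_A @` K = (J_A - idfun) @` (-%R @` fixed_points T_BA)
    & affine_relation B ->
      [/\ T_AB \o R_B \o R_A = R_B \o R_A \o T_AB,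
          4 *: ((T_AB \o T_BA) - (T_BA \o T_AB))
            = (R_B \o iter 2 R_A \o R_B) - (R_A \o iter 2 R_B \o R_A) /\
          (T_AB \o T_BA = T_BA \o T_AB <->
           R_B \o iter 2 R_A \o R_B = R_A \o iter 2 R_B \o R_A)
        & iter 2 R_A = idfun -> iter 2 R_B = idfun ->
          T_AB \o T_BA = T_BA \o T_AB]].
Proof.
move=> J_A R_A R_B T_AB T_BA Z K.
have JA_aff : affine_map J_A := affine_resolvent ip_norm A_max A_aff.
have RA_aff : affine_map R_A := affine_reflected_resolvent JA_aff.
split; first by move=> n; apply/iter_intertwine/reflected_douglas_rachford.
  rewrite /Z /K (primal_solutionsE ip_norm A_max B_max).
  rewrite (dual_solutionsE ip_norm A_max B_max).
  rewrite -(reflected_fixed_points A B) !image_comp; split.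
    apply: eq_imagel => x _ /=; rewrite /R_A /reflected_resolvent.
    by rewrite (affine_map_reflect _ _ JA_aff).
  apply: eq_imagel => x _ /=.
  (* [(J_A - Id) (- R_A x)] evaluates [J_A] at [x - 2 J_A x], whose midpoint
     with [x] is [x - J_A x], the point at which [R_A] is evaluated. *)
  have := affine_map_mid (x - 2 *: J_A x) x JA_aff.
  have -> : x - 2 *: J_A x + x = (x - J_A x) + (x - J_A x).
    by rewrite addrACA -opprD -(scaler2 (J_A x)) addrAC.
  rewrite half_scale => mid.
  rewrite [LHS]/reflected_resolvent -/J_A mid scalerA mulfV ?pnatr_eq0 //.
  rewrite scale1r !fctE /= /R_A /reflected_resolvent -/J_A !opprB.
  by rewrite scaler2 -addrA; congr (_ + _); rewrite addrA.
move=> B_aff.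
have RB_aff : affine_map R_B.
  exact: affine_reflected_resolvent (affine_resolvent ip_norm B_max B_aff).
have iv : 4 *: ((T_AB \o T_BA) - (T_BA \o T_AB))
    = (R_B \o iter 2 R_A \o R_B) - (R_A \o iter 2 R_B \o R_A).
  apply/funext => x; rewrite !fctE /= scalerBr !douglas_rachford_comp //.
  by rewrite (addrAC x (R_B (R_A x))) opprD addrACA subrr add0r.
have comm : T_AB \o T_BA = T_BA \o T_AB <->
    R_B \o iter 2 R_A \o R_B = R_A \o iter 2 R_B \o R_A.
  split=> /eqP; rewrite -subr_eq0 => /eqP e; apply/eqP; rewrite -subr_eq0.
    by rewrite -iv e scaler0.
  by have /eqP := iv; rewrite e scaler_eq0 pnatr_eq0.
split=> //.
- apply/funext => x /=.
  exact/esym/(affine_map_mid _ _ (affine_map_comp RB_aff RA_aff)).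
- move=> RA2 RB2; apply/comm; rewrite RA2 RB2; exact: etrans RB2 (esym RA2).
Qed.
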